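(* Let $q$ be a prime power and $0<\delta<1-\frac1q$. Let $H$ be a graph with $v$ vertices and $m$ edges, fix a vertex $r\in V(H)$, and let $\Omega=\{x:V(H)\to\mathbb{F}_q : x_r=0\}$. Define $$\Phi_{H,q}(\delta):=\max\left\{\mathcal H_q(\mu)\ :\ \mu \text{ a probability distribution on }\Omega\text{ with } \Pr_\mu(x_u\neq x_w)\leq\delta\text{ for every edge }uw\in E(H)\right\}.$$ Then $$\Phi_{H,q}(\delta)\ \geq\ v-1-m+m\,h_q(\delta).$$
   Context: Graphs are finite and simple, and $x_u$ denotes the value of $x\in\Omega$ at the vertex $u$. For a probability distribution $\mu$ on a finite set $\Omega$, $\mathcal H_q(\mu)=-\sum_{x\in\Omega}\mu(x)\log_q\mu(x)$ is its base-$q$ entropy, with the convention $0\log_q 0=0$. The function $h_q$ is $$h_q(\delta)=-(1-\delta)\log_q(1-\delta)-\delta\log_q\left(\frac{\delta}{q-1}\right).$$ *)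

(* Defs.v *)
From HB Require Import structures.
From mathcomp Require Import all_boot all_order all_algebra.
From mathcomp Require Import all_classical all_reals all_analysis.

Set Implicit Arguments.
Unset Strict Implicit.
Unset Printing Implicit Defensive.

Import Order.TTheory GRing.Theory Num.Theory.
Import numFieldTopology.Exports numFieldNormedType.Exports.

Local Open Scope classical_set_scope.
Local Open Scope ring_scope.

Record sgraph (V : finType) := SGraph {
  adj : rel V;
  adj_sym : symmetric adj;
  adj_irrefl : irreflexive adj }.

(* Edges are unordered pairs, so [#|edges H|] counts each edge once. *)
Definition edges (V : finType) (H : sgraph V) : {set {set V}} :=
  [set [set p.1; p.2]%SET | p : V * V & adj H p.1 p.2]%SET.

Definition Omega (V : finType) (F : finFieldType) (r : V) : finType :=
  {x : {ffun V -> F} | x r == 0}.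

Definition logq (R : realType) (q : nat) (t : R) : R := ln t / ln q%:R.

(* [ln] is total with [ln 0 = 0], so [0 * logq q 0 = 0] as required. *)
Definition entropy (R : realType) (q : nat) (T : finType) (mu : T -> R) : R :=
  - \sum_(x : T) mu x * logq q (mu x).

Definition h_q (R : realType) (q : nat) (delta : R) : R :=
  - (1 - delta) * logq q (1 - delta) - delta * logq q (delta / (q%:R - 1)).

Definition is_distr (R : realType) (T : finType) (mu : T -> R) : Prop :=
  (forall x, 0 <= mu x) /\ \sum_(x : T) mu x = 1.

Definition Pr (R : realType) (T : finType) (mu : T -> R) (A : pred T) : R :=
  \sum_(x : T | A x) mu x.

Definition feasible (R : realType) (V : finType) (F : finFieldType)
    (H : sgraph V) (r : V) (delta : R) : set (Omega F r -> R) :=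
  [set mu | is_distr mu /\
    forall u w : V, adj H u w ->
      Pr mu (fun x : Omega F r => val x u != val x w) <= delta].

(* The supremum is attained for [0 <= delta]: see [Phi_max] below. *)
Definition Phi (R : realType) (V : finType) (F : finFieldType)
    (H : sgraph V) (r : V) (delta : R) : R :=
  sup [set entropy #|F| mu | mu in @feasible R V F H r delta].

Lemma normr_xlnx (R : realType) (x : R) :
  x < 1 -> `|x * ln x| <= 2 * Num.sqrt x.
Proof.
move=> x1; have [x0|x0] := leP x 0.
  by rewrite ln0// mulr0 normr0 mulr_ge0.
have s0 : 0 < Num.sqrt x by rewrite sqrtr_gt0.
rewrite ler0_norm; last by rewrite pmulr_rle0// ln_le0// ltW.
have -> : ln x = 2 * ln (Num.sqrt x).
  by rewrite -{1}(sqr_sqrtr (ltW x0)) lnXn// mulr_natl.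
have : - ln (Num.sqrt x) <= (Num.sqrt x)^-1.
  by rewrite -lnV ?posrE// ltW// ln_sublinear// invr_gt0.
rewrite -(ler_pM2l s0) divff ?gt_eqF// => h.
rewrite -{1}(sqr_sqrtr (ltW x0)) (_ : - _ =
  2 * Num.sqrt x * (Num.sqrt x * - ln (Num.sqrt x))); last first.
  by rewrite expr2 !mulrN mulrCA -!mulrA.
by rewrite -[leRHS]mulr1 ler_pM2l// mulr_gt0.
Qed.

Lemma xlnx_continuous (R : realType) : continuous (fun x : R => x * ln x).
Proof.
move=> x.
have [x0|x0|->] := ltgtP x 0.
- rewrite /continuous_at ln0 ?ltW// mulr0.
  have : (fun=> (0 : R)) y @[y --> x] --> (0 : R) by exact: cvg_cst.
  apply: cvg_trans; apply: near_eq_cvg; near=> y; rewrite (@ln0 _ y) ?mulr0//.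
  by apply: ltW; near: y; exact: lt_nbhsl.
- by apply: cvgM; [exact: cvg_id|exact: continuous_ln].
rewrite /continuous_at mul0r; apply/norm_cvg0P.
apply: (@squeeze_cvgr _ _ _ _ (fun=> 0) (fun x : R => 2 * Num.sqrt x)).
- near=> y; rewrite normr_ge0/= normr_xlnx//.
  by near: y; exact: lt_nbhsl.
- exact: cvg_cst.
- have -> : nbhs (0 : R) = nbhs (2 * Num.sqrt 0 : R) by rewrite sqrtr0 mulr0.
  by apply: cvgMl_tmp; exact: sqrt_continuous.
Unshelve. all: by end_near. Qed.

Section attained.
Import ArrowAsProduct.

Lemma continuous_sum_coord (R : realType) (T : finType) (A : pred T)
    (g : R -> R) :
  continuous g -> continuous (fun mu : T -> R => \sum_(x : T | A x) g (mu x)).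
Proof.
move=> cg mu.
have addc : continuous (fun x : R * R => x.1 + x.2).
  by move=> x; apply: cvgD; [exact: cvg_fst|exact: cvg_snd].
have := @cvg_big R T +%R 0 A addc (T -> R) (nbhs mu)
  (index_enum T) (fun x nu => g (nu x)) (fun x => g (mu x)) (nbhs_filter mu).
apply.
move=> x _; apply: (@continuous_comp _ _ _ (fun nu : T -> R => nu x) g).
  exact: (@proj_continuous T (fun=> R) x).
exact: cg.
Qed.

Lemma continuous_entropy (R : realType) (q : nat) (T : finType) :
  continuous (@entropy R q T).
Proof.
have -> : @entropy R q T =
    (fun mu : T -> R => \sum_(x : T) - (mu x * ln (mu x) / ln q%:R)).
  apply/funext => mu; rewrite sumrN; congr (- _).
  by apply: eq_bigr => x _; rewrite mulrA.
apply: (@continuous_sum_coord R T predT (fun t => - (t * ln t / ln q%:R))).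
move=> t; apply: cvgN; apply: (@cvgMr_tmp R _ _ _ (fun t : R => t * ln t)).
exact: xlnx_continuous.
Qed.

Lemma compact_feasible (R : realType) (V : finType) (F : finFieldType)
  (H : sgraph V) (r : V) (delta : R) : compact (@feasible R V F H r delta).
Proof.
set T : finType := Omega F r.
have idc : continuous (@id R) by move=> ?; exact: cvg_id.
have := @subclosed_compact _ (@feasible R V F H r delta)
  [set f : T -> R | forall x, `[0, 1]%classic (f x)].
apply.
- have -> : @feasible R V F H r delta =
    (\bigcap_(x in [set: T]) [set mu : T -> R | 0 <= mu x]) `&`
    [set mu : T -> R | \sum_(x : T) mu x = 1] `&`
    (\bigcap_(p in [set p : V * V | adj H p.1 p.2])
      [set mu : T -> R | Pr mu (fun x => val x p.1 != val x p.2) <= delta]).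
    apply/seteqP; split => mu.
      move=> [[h0 h1] h2]; split; first by split => // x _; exact: h0.
      by move=> p; exact: h2.
    move=> [[h0 h1] h2]; split; first by split => // x; exact: h0.
    by move=> u w uw; exact: (h2 (u, w)).
  apply: closedI; [apply: closedI|].
  + apply: closed_bigI => x _.
    apply: (@closed_comp _ _ (fun mu : T -> R => mu x) [set t | 0 <= t]).
      by move=> mu _; exact: (@proj_continuous T (fun=> R) x).
    exact: closed_ge.
  + apply: (@closed_comp _ _ (fun mu : T -> R => \sum_(x : T) mu x)
      [set t | t = 1]).
      by move=> mu _; exact: (continuous_sum_coord idc).
    exact: closed_eq.
  + apply: closed_bigI => p _.
    apply: (@closed_comp _ _ (fun mu : T -> R =>
      Pr mu (fun x => val x p.1 != val x p.2)) [set t | t <= delta]).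
      by move=> mu _; exact: (continuous_sum_coord idc).
    exact: closed_le.
- exact: (@tychonoff T (fun=> R) (fun=> `[0, 1]%classic) (fun=> @segment_compact R 0 1)).
- move=> mu [[h0 h1] _] x /=; rewrite in_itv/= h0/= -h1.
  by rewrite (bigD1 x)//= lerDl sumr_ge0.
Qed.

Lemma feasible_dirac0 (R : realType) (V : finType) (F : finFieldType)
    (H : sgraph V) (r : V) (delta : R) :
  0 <= delta -> @feasible R V F H r delta !=set0.
Proof.
move=> d0; have p0 : [ffun _ : V => 0 : F] r == 0 by rewrite ffunE.
pose z : Omega F r := Sub [ffun=> 0] p0.
exists (fun x => (x == z)%:R); split; first split => //.
- by rewrite (bigD1 z)//= eqxx big1 ?addr0// => x /negbTE ->.
- move=> u w _; rewrite /Pr big1// => x.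
  by have [->|//] := eqVneq x z; rewrite /= !ffunE eqxx.
Qed.

Lemma Phi_max (R : realType) (V : finType) (F : finFieldType)
    (H : sgraph V) (r : V) (delta : R) : 0 <= delta ->
  (exists2 mu, @feasible R V F H r delta mu &
     entropy #|F| mu = Phi F H r delta) /\
  (forall mu, @feasible R V F H r delta mu ->
     entropy #|F| mu <= Phi F H r delta).
Proof.
move=> d0.
have [c /set_mem cA cmax] := compact_EVT_max (feasible_dirac0 F H r d0)
  (@compact_feasible R V F H r delta)
  (continuous_subspaceT (@continuous_entropy R #|F| (Omega F r))).
have cub : ubound [set entropy #|F| mu | mu in @feasible R V F H r delta]
    (entropy #|F| c).
  by move=> _ [mu muA <-]; apply: cmax; exact: mem_set.
have PhiE : entropy #|F| c = Phi F H r delta.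
  apply/eqP; rewrite eq_le; apply/andP; split.
    by apply: ub_le_sup; [exists (entropy #|F| c)|exists c].
  by apply: ge_sup => //; exists (entropy #|F| c), c.
split; first by exists c.
by move=> mu muA; rewrite -PhiE; apply: cub; exists mu.
Qed.

End attained.

(* Main.v *)
Require Import Defs.
From HB Require Import structures.
From mathcomp Require Import all_boot all_order all_algebra.
From mathcomp Require Import all_classical all_reals all_analysis.
From mathcomp Require Import ring lra.

Import Order.TTheory GRing.Theory Num.Theory.
Local Open Scope ring_scope.

(** The bound comes from convex duality for entropy maximisation combined with
    a first-order lower bound on a ferromagnetic Potts partition function.

    For multipliers [lam e >= 0] on the edges, the Gibbs distribution gives [x]
    a weight proportional to the product of [exp (- lam e)] over the edges [e]
    that [x] cuts, that is, gives different values to their ends. With [Z lam]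
    the normalising constant, the dual function
    [ln (Z lam) + delta * \sum_e lam e] has partial derivative
    [delta - Pr (e is cut)]. It therefore attains a minimum over [lam >= 0]
    (the zero configuration cuts nothing, so [Z >= 1] and the linear term
    makes the dual coercive), and a minimiser satisfies the
    Karush-Kuhn-Tucker conditions: every edge is cut with probability at most
    [delta], with equality where [lam e > 0] ([gibbs_kkt]). So its Gibbs
    distribution is feasible, and by complementary slackness its entropy, in
    nats, is exactly the dual value ([entropy_gibbs]).

    It remains to bound the dual value from below at an arbitrary [lam >= 0].
    Put [t e = exp (- lam e)]. Each factor of a Gibbs weight is
    [t e + (1 - t e) * 1_(e is not cut)], and requiring that an edge be
    uncut divides the size of a subgroup of configurations by at most [q].
    Adding the edges one by one gives ([weighted_sum_ge])
      [Z lam >= q ^ (v - 1) * \prod_e ((1 + (q - 1) * t e) / q)],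
    which is an equality when the graph is a tree. Finally
    [ln (1 + (q - 1) * exp (- s)) + delta * s >= h_q delta * ln q] for every
    [s] ([h_legendre_le]); applied once per edge this gives the
    claimed bound after division by [ln q]. *)

(** * Gibbs distributions and the dual function *)

(** Joins the finite-type and the additive structures of [{ffun V -> F}], so
    that sets of configurations can be treated as subsets of a finite group. *)
HB.instance Definition _ (V : finType) (F : finZmodType) :=
  GRing.Zmodule.on {ffun V -> F}.

(** In these definitions [d i x] says that [x] violates the [i]-th constraint,
    and [lam i] is the price of that violation. *)
Definition gibbs_weight {R : realType} {I T : finType} (d : I -> pred T)
    (lam : I -> R) (x : T) : R :=
  expR (- \sum_(i | d i x) lam i).

Definition partition_fun {R : realType} {I T : finType} (d : I -> pred T)
    (lam : I -> R) : R :=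
  \sum_x gibbs_weight d lam x.

Definition gibbs {R : realType} {I T : finType} (d : I -> pred T)
    (lam : I -> R) (x : T) : R :=
  gibbs_weight d lam x / partition_fun d lam.

Definition dual {R : realType} {I T : finType} (delta : R) (d : I -> pred T)
    (lam : I -> R) : R :=
  ln (partition_fun d lam) + delta * \sum_i lam i.

Definition shift {R : realType} {I : finType} (lam : I -> R) (i : I) (s : R)
    : I -> R :=
  fun j => lam j + (if j == i then s else 0).

Lemma partition_fun_gt0 {R : realType} {I T : finType} {d : I -> pred T}
    (lam : I -> R) (x0 : T) :
  0 < partition_fun d lam.
Proof.
rewrite /partition_fun (bigD1 x0)//= ltr_wpDr ?expR_gt0//.
by apply: sumr_ge0 => x _; exact: expR_ge0.
Qed.

Lemma partition_fun_ge1 {R : realType} {I T : finType} {d : I -> pred T}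
    (lam : I -> R) (x0 : T) (hx0 : forall i, ~~ d i x0) :
  1 <= partition_fun d lam.
Proof.
have W0 : gibbs_weight d lam x0 = 1.
  rewrite /gibbs_weight big_pred0 ?oppr0 ?expR0// => i.
  exact/negbTE/hx0.
rewrite /partition_fun (bigD1 x0)//= W0 lerDl.
by apply: sumr_ge0 => x _; exact: expR_ge0.
Qed.

Lemma gibbs_is_distr {R : realType} {I T : finType} {d : I -> pred T}
    (lam : I -> R) (x0 : T) :
  is_distr (gibbs d lam).
Proof.
have Z0 := partition_fun_gt0 (d := d) lam x0.
split=> [x|]; first by rewrite divr_ge0 ?expR_ge0// ltW.
by rewrite -mulr_suml divff ?gt_eqF.
Qed.

Lemma sum_shift {R : realType} {I : finType} (P : pred I) (lam : I -> R)
    (i : I) (s : R) :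
  \sum_(j | P j) shift lam i s j
  = \sum_(j | P j) lam j + (if P i then s else 0).
Proof.
rewrite big_split/=; congr (_ + _).
rewrite -big_mkcondr/=; case: ifPn => Pi.
  by rewrite (big_pred1 i)// => j /=; case: eqVneq => [->|]; rewrite ?Pi ?andbF.
by rewrite big_pred0// => j; case: eqVneq => [->|]; rewrite ?(negbTE Pi) ?andbF.
Qed.

(** Raising [lam i] by [s] multiplies by [exp (- s)] the weights of the points
    with [d i x], which carry the fraction [Pr (gibbs d lam) (d i)] of [Z]. *)
Lemma partition_fun_shift {R : realType} {I T : finType} {d : I -> pred T}
    (lam : I -> R) (x0 : T) (i : I) (s : R) :
  partition_fun d (shift lam i s)
  = partition_fun d lam * (1 - Pr (gibbs d lam) (d i) * (1 - expR (- s))).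
Proof.
have Z0 := partition_fun_gt0 (d := d) lam x0.
rewrite mulrBr mulr1 mulrA [X in _ - X * _](_ : _ =
    \sum_(x | d i x) gibbs_weight d lam x); last first.
  by rewrite /Pr -mulr_suml mulrC divfK ?gt_eqF.
rewrite mulr_suml [X in _ - X]big_mkcond/= /partition_fun -sumrB.
apply: eq_bigr => x _; rewrite /gibbs_weight sum_shift.
by case: ifP => _; rewrite ?addr0 ?subr0// opprD expRD; ring.
Qed.

(** A derivative-free form of the fact that the partial derivative of the dual
    function is [delta - Pr (gibbs d lam) (d i)]. *)
Lemma dual_shift_le {R : realType} {I T : finType} {d : I -> pred T}
    (delta : R) (lam : I -> R) (x0 : T) (i : I) (s : R) :
  dual delta d (shift lam i s)
  <= dual delta d lam + delta * s - Pr (gibbs d lam) (d i) * (1 - expR (- s)).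
Proof.
have Z0 := partition_fun_gt0 (d := d) lam x0.
have := partition_fun_gt0 (d := d) (shift lam i s) x0.
rewrite /dual sum_shift/= (partition_fun_shift lam x0) pmulr_rgt0// => c0.
rewrite lnM ?posrE//; move: (Pr _ _ * _) c0 => c c0.
have : ln (1 + - c) <= - c by apply: le_ln1Dx; lra.
by rewrite mulrDr; lra.
Qed.

(** * Minimising the dual function *)

Section compactness.
Import numFieldTopology.Exports numFieldNormedType.Exports.
Import ArrowAsProduct.
Local Open Scope classical_set_scope.

Lemma continuous_dual {R : realType} {I T : finType} (d : I -> pred T)
    (delta : R) (x0 : T) :
  continuous (fun lam : I -> R => dual delta d lam).
Proof.
have idc : continuous (@id R) by move=> ?; exact: cvg_id.
have sumc (P : pred I) : continuous (fun lam : I -> R => \sum_(i | P i) lam i).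
  exact: (continuous_sum_coord idc).
have addc : continuous (fun x : R * R => x.1 + x.2).
  by move=> x; apply: cvgD; [exact: cvg_fst|exact: cvg_snd].
have Zc : continuous (fun lam : I -> R => partition_fun d lam).
  move=> lam.
  have := @cvg_big R T +%R 0 predT addc (I -> R) (nbhs lam)
    (index_enum T) (fun x nu => gibbs_weight d nu x)
    (fun x => gibbs_weight d lam x) (nbhs_filter lam).
  apply=> x _.
  apply: (@continuous_comp _ _ _
    (fun lam : I -> R => - \sum_(i | d i x) lam i) expR).
    have sc := sumc (fun i => d i x) lam.
    exact: (cvgN sc).
  exact: continuous_expR.
move=> lam.
have lnZc : {for lam, continuous (fun l : I -> R => ln (partition_fun d l))}.
  apply: (@continuous_comp _ _ _ (fun l : I -> R => partition_fun d l) (@ln R)).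
    exact: Zc.
  by apply: continuous_ln; exact: partition_fun_gt0.
have dc : {for lam, continuous (fun l : I -> R => delta * \sum_i l i)}.
  by have sc := sumc xpredT lam; exact: (cvgMl_tmp sc).
exact: (cvgD lnZc dc).
Qed.

Lemma dual_min_on_cube {R : realType} {I T : finType} (d : I -> pred T)
    (delta L : R) (x0 : T) (hL : 0 <= L) :
  exists2 lam : I -> R, (forall i, 0 <= lam i <= L) &
    forall nu : I -> R, (forall i, 0 <= nu i <= L) ->
      dual delta d lam <= dual delta d nu.
Proof.
pose C := [set l : I -> R | forall i, `[0, L]%classic (l i)].
have C0 : C !=set0 by exists (fun=> 0) => i /=; rewrite in_itv/= lexx.
have cC : compact C.
  exact: (@tychonoff I (fun=> R) (fun=> `[0, L]%classic)
    (fun=> @segment_compact R 0 L)).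
have [lam /set_mem lamC lamP] := compact_EVT_min C0 cC
  (continuous_subspaceT (continuous_dual d delta x0)).
exists lam => [i|nu nuC]; first by have := lamC i; rewrite /= in_itv.
by apply: lamP; apply: mem_set => i; rewrite /= in_itv; exact: nuC.
Qed.

End compactness.

(** This and [slope_ge] turn the comparison of a minimum with its perturbations
    into first-order conditions. If the conclusion failed, a step [s] of size at
    most [`|ln (P / delta)|] would contradict the hypothesis, by the strict
    inequality [1 + y < expR y] for [y != 0]. *)
Lemma slope_le {R : realType} (P delta b : R) (hdelta : 0 < delta) (hb : 0 < b)
    (h : forall s, 0 < s <= b -> P * (1 - expR (- s)) <= delta * s) :
  P <= delta.
Proof.
rewrite leNgt; apply/negP => dP.
have P0 : 0 < P by lra.
pose s := Num.min b (ln (P / delta)).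
have s0 : 0 < s by rewrite lt_min hb ln_gt0// ltr_pdivlMr// mul1r.
have es : delta * expR s <= P.
  rewrite mulrC -ler_pdivlMr// -[leRHS]lnK ?posrE ?divr_gt0//.
  by rewrite ler_expR ge_min lexx orbT.
have sb : 0 < s <= b by rewrite s0 ge_min lexx.
have lt1 : 1 + s < expR s by apply: expR_gt1Dx; rewrite gt_eqF.
have : P * (expR s - 1) <= P * s.
  have -> : expR s - 1 = (1 - expR (- s)) * expR s.
    by rewrite mulrBl mul1r -expRD addNr expR0.
  rewrite mulrA; apply: (le_trans (ler_wpM2r (expR_ge0 s) (h s sb))).
  by rewrite mulrAC ler_pM2r.
by rewrite ler_pM2l//; lra.
Qed.

Lemma slope_ge {R : realType} (P delta b : R) (hdelta : 0 < delta)
    (hP : 0 <= P) (hb : 0 < b)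
    (h : forall s, 0 < s <= b -> delta * s <= P * (expR s - 1)) :
  delta <= P.
Proof.
rewrite leNgt; apply/negP => Pd.
have [P0|P0] := leP P 0.
  have := h b; rewrite hb lexx (_ : P = 0) ?mul0r; last by lra.
  by move=> /(_ isT); rewrite leNgt mulr_gt0.
pose s := Num.min b (ln (delta / P)).
have s0 : 0 < s by rewrite lt_min hb ln_gt0// ltr_pdivlMr// mul1r.
have es : P * expR s <= delta.
  rewrite mulrC -ler_pdivlMr// -[leRHS]lnK ?posrE ?divr_gt0//.
  by rewrite ler_expR ge_min lexx orbT.
have sb : 0 < s <= b by rewrite s0 ge_min lexx.
have lt1 : 1 + - s < expR (- s) by apply: expR_gt1Dx; rewrite oppr_eq0 gt_eqF.
have : P * (expR s - 1) < P * expR s * s.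
  rewrite -mulrA ltr_pM2l// -[X in _ - X < _](_ : expR s * expR (- s) = 1).
    by rewrite -[X in X - _]mulr1 -mulrBr ltr_pM2l ?expR_gt0//; lra.
  by rewrite -expRD subrr expR0.
rewrite ltNge => /negP; apply; apply: le_trans (h s sb).
by rewrite ler_pM2r.
Qed.

(** Karush-Kuhn-Tucker conditions. The second one is complementary slackness.
    The point [x0], which violates nothing, keeps [Z >= 1] and hence confines
    the minimisers to a bounded box. *)
Lemma gibbs_kkt {R : realType} {I T : finType} (d : I -> pred T)
    (delta : R) (x0 : T) (hx0 : forall i, ~~ d i x0) (hdelta : 0 < delta) :
  exists2 lam : I -> R, (forall i, 0 <= lam i) &
    forall i, Pr (gibbs d lam) (d i) <= delta /\
      lam i * Pr (gibbs d lam) (d i) = lam i * delta.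
Proof.
(* On the face [lam i = L] the dual value is at least [delta * L > D0], so a
   minimiser over the cube never touches the upper faces. *)
pose D0 := dual delta d (fun=> 0); pose L := (D0 + 1) / delta.
have D0ge0 : 0 <= D0.
  by rewrite /D0 /dual big1// mulr0 addr0 ln_ge0// (partition_fun_ge1 _ x0).
have L0 : 0 <= L by rewrite divr_ge0 ?ltW//; lra.
have [lam lamC lam_min] := dual_min_on_cube d delta L x0 L0.
have lam0 i : 0 <= lam i by have /andP[] := lamC i.
have lamL i : lam i < L.
  rewrite ltr_pdivlMr//.
  have : dual delta d lam <= D0 by apply: lam_min => j; rewrite lexx.
  have lnZ : 0 <= ln (partition_fun d lam).
    by rewrite ln_ge0// (partition_fun_ge1 _ x0).
  have : delta * lam i <= delta * \sum_j lam j.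
    by rewrite ler_pM2l// (bigD1 i)//= lerDl sumr_ge0.
  by rewrite /dual; lra.
exists lam => // i; set P := Pr _ _.
have step s : 0 <= lam i + s <= L -> P * (1 - expR (- s)) <= delta * s.
  move=> sC; have := dual_shift_le (d := d) delta lam x0 i s.
  have : dual delta d lam <= dual delta d (shift lam i s).
    apply: lam_min => j; rewrite /shift.
    by case: eqVneq => [->//|_]; rewrite addr0.
  by rewrite -/P; lra.
have P0 : 0 <= P.
  by apply: sumr_ge0 => x _; have [+ _] := gibbs_is_distr (d := d) lam x0; apply.
have Ple : P <= delta.
  apply: (slope_le P delta (L - lam i)); rewrite ?subr_gt0// => s sb.
  by apply: step; have := lam0 i; lra.
split=> //; have [->|li] := eqVneq (lam i) 0; first by rewrite !mul0r.
have li0 : 0 < lam i by rewrite lt_neqAle eq_sym li lam0.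
have sle s : 0 < s <= lam i -> delta * s <= P * (expR s - 1).
  move=> sb; have := step (- s); rewrite opprK.
  by rewrite (_ : _ <= _ <= _); [move=> /(_ isT); lra|have := lamL i; lra].
congr (_ * _); apply/eqP; rewrite eq_le Ple.
exact: (slope_ge P delta (lam i)).
Qed.

(** For a Gibbs distribution [- ln (mu x)] is [ln Z] plus the total price of
    the violations of [x]; this averages to the formula below. *)
Lemma entropy_gibbs {R : realType} {I T : finType} (d : I -> pred T)
    (q : nat) (lam : I -> R) (x0 : T) :
  entropy q (gibbs d lam)
  = (ln (partition_fun d lam) + \sum_i lam i * Pr (gibbs d lam) (d i))
    / ln q%:R.
Proof.
have Z0 := partition_fun_gt0 (d := d) lam x0.
have [_ mu1] := gibbs_is_distr (d := d) lam x0.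
have -> : \sum_i lam i * Pr (gibbs d lam) (d i)
    = \sum_x gibbs d lam x * \sum_(i | d i x) lam i.
  under eq_bigr do rewrite /Pr big_mkcond/= mulr_sumr.
  rewrite exchange_big/=; apply: eq_bigr => x _.
  rewrite mulr_sumr [RHS]big_mkcond/=; apply: eq_bigr => i _.
  by case: ifP => _; rewrite ?mulr0// mulrC.
rewrite -[X in (X + _) / _]mul1r -{1}mu1 mulr_suml -big_split/= mulr_suml.
rewrite /entropy -sumrN; apply: eq_bigr => x _.
rewrite /logq {2}/gibbs ln_div ?posrE ?expR_gt0// expRK.
by rewrite -mulrDr mulrA -mulNr -mulrN; congr (_ * _ / _); ring.
Qed.

(** * A lower bound on the partition function *)

(** Each nonempty fibre of [f] on [S] is a translate of a part of the kernel. *)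
Lemma card_subgroup_le_kernel {G F : finZmodType} (f : G -> F)
    (hf : {morph f : x y / x - y}) (S : {set G})
    (hS : {in S &, forall x y, x - y \in S}) :
  (#|S| <= #|F| * #|[set x in S | f x == 0%R]|)%N.
Proof.
rewrite -sum1_card (partition_big f xpredT)//= -sum_nat_const.
apply: leq_sum => c _; rewrite sum1dep_card.
have [->|[y]] := set_0Vmem [set x in S | f x == c]; first by rewrite cards0.
rewrite inE => /andP[yS /eqP fy].
rewrite -(card_imset _ (addIr (- y))); apply: subset_leq_card.
apply/fintype.subsetP => _ /imsetP[x + ->]; rewrite !inE => /andP[xS /eqP fx].
by rewrite hS// hf fx fy subrr eqxx.
Qed.

(** Induction on the constraints, with [S] varying: the factor of [a] is
    [t a + (1 - t a) * 1_(f a x == 0)], so the sum over [S] is [t a] times the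
    sum over [S] plus [1 - t a] times the sum over the subgroup [K] of [S]
    where [f a] vanishes, and [K] has size at least [#|S| / #|F|]. *)
Lemma weighted_sum_ge {R : realType} {G F : finZmodType} {I : Type}
    (f : I -> G -> F) (hf : forall i, {morph f i : x y / x - y})
    (t : I -> R) (ht : forall i, 0 <= t i <= 1) (s : seq I) (S : {set G})
    (hS : {in S &, forall x y, x - y \in S}) :
  #|S|%:R * \prod_(i <- s) ((1 + (#|F|%:R - 1) * t i) / #|F|%:R)
  <= \sum_(x in S) \prod_(i <- s | f i x != 0) t i.
Proof.
have F0 : 0 < #|F|%:R :> R by rewrite ltr0n; apply/card_gt0P; exists 0.
have F1 : 1 <= #|F|%:R :> R by rewrite ler1n -(ltr0n R).
elim: s S hS => [|a s IH] S hS.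
  rewrite big_nil mulr1; under eq_bigr do rewrite big_nil.
  by rewrite sumr_const.
have /andP[ta0 ta1] := ht a.
set w := fun x => \prod_(i <- s | f i x != 0) t i.
pose K := [set x in S | f a x == 0].
have hK : {in K &, forall x y, x - y \in K}.
  move=> x y; rewrite !inE => /andP[xS /eqP fx] /andP[yS /eqP fy].
  by rewrite hS// hf fx fy subrr eqxx.
have -> : \sum_(x in S) \prod_(i <- a :: s | f i x != 0) t i
    = t a * \sum_(x in S) w x + (1 - t a) * \sum_(x in K) w x.
  have KE x : (x \in K) = (x \in S) && (f a x == 0) by rewrite inE.
  rewrite [X in _ = _ + _ * X](eq_bigl _ _ KE).
  rewrite big_mkcondr/= !mulr_sumr -big_split/=; apply: eq_bigr => x _.
  by rewrite big_cons -/(w x); case: eqP => _ /=; ring.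
rewrite big_cons; set c := \prod_(i <- s) _.
have c0 : 0 <= c.
  apply: prodr_ge0 => i _; have /andP[ti0 _] := ht i.
  by rewrite mulr_ge0 ?invr_ge0 ?(ltW F0)// addr_ge0// mulr_ge0// subr_ge0.
apply: (@le_trans _ _ (t a * (#|S|%:R * c) + (1 - t a) * (#|K|%:R * c))).
  have -> : t a * (#|S|%:R * c) + (1 - t a) * (#|K|%:R * c)
    = (t a * #|S|%:R + (1 - t a) * #|K|%:R) * c by ring.
  rewrite mulrA ler_wpM2r//.
  have : #|S|%:R / #|F|%:R <= #|K|%:R :> R.
    rewrite ler_pdivrMr// mulrC -natrM ler_nat.
    exact: (card_subgroup_le_kernel (f a)).
  move: (#|S|%:R) (#|K|%:R) (#|F|%:R) F0 => A B n n0 AB.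
  have -> : A * ((1 + (n - 1) * t a) / n) = t a * A + (1 - t a) * (A / n).
    by field; rewrite gt_eqF.
  by rewrite lerD2l ler_wpM2l// subr_ge0.
by rewrite lerD// ler_wpM2l ?subr_ge0// IH.
Qed.

Lemma ln_weighted_sum_ge {R : realType} {G F : finZmodType} {I : finType}
    (f : I -> G -> F) (hf : forall i, {morph f i : x y / x - y})
    (lam : I -> R) (hlam : forall i, 0 <= lam i) (S : {set G})
    (hS : {in S &, forall x y, x - y \in S}) (hS0 : (0 < #|S|)%N) :
  ln #|S|%:R
  + \sum_i (ln (1 + (#|F|%:R - 1) * expR (- lam i)) - ln #|F|%:R)
  <= ln (\sum_(x in S) \prod_(i | f i x != 0) expR (- lam i)).
Proof.
have F0 : (0 < #|F|)%N by apply/card_gt0P; exists 0.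
have Q0 : 0 < #|F|%:R :> R by rewrite ltr0n.
have S0 : 0 < #|S|%:R :> R by rewrite ltr0n.
have t01 i : 0 <= expR (- lam i) <= 1.
  by rewrite expR_ge0 /= -expR0 ler_expR oppr_le0.
have b0 i : 0 < 1 + (#|F|%:R - 1) * expR (- lam i).
  by rewrite ltr_pwDl// mulr_ge0 ?expR_ge0// subr_ge0 ler1n.
have bq0 i : 0 < (1 + (#|F|%:R - 1) * expR (- lam i)) / #|F|%:R.
  by rewrite divr_gt0.
have -> : \sum_i (ln (1 + (#|F|%:R - 1) * expR (- lam i)) - ln #|F|%:R)
    = ln (\prod_i ((1 + (#|F|%:R - 1) * expR (- lam i)) / #|F|%:R)).
  apply: expR_inj; rewrite expR_sum lnK ?posrE ?prodr_gt0//.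
  by apply: eq_bigr => i _; rewrite -ln_div ?posrE// lnK ?posrE.
have lhs0 : 0 < #|S|%:R
    * \prod_i ((1 + (#|F|%:R - 1) * expR (- lam i)) / #|F|%:R).
  by rewrite mulr_gt0 ?prodr_gt0.
have W := weighted_sum_ge f hf _ t01 (index_enum I) S hS.
by rewrite -lnM ?posrE ?prodr_gt0// ler_ln ?posrE// (lt_le_trans lhs0 W).
Qed.

(** Evaluation at [r] has the configurations vanishing at [r] as kernel. *)
Lemma card_rooted_ge {V : finType} {F : finZmodType} (r : V) :
  (#|F| ^ #|V| <= #|F| * #|[set x : {ffun V -> F} | x r == 0%R]|)%N.
Proof.
have evB : {morph (fun x : {ffun V -> F} => x r) : x y / x - y}.
  by move=> x y; rewrite !ffunE.
have := card_subgroup_le_kernel _ evB finset.setT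
  (fun x y _ _ => finset.in_setT _).
rewrite cardsT card_ffun => /leq_trans; apply.
rewrite leq_mul2l; apply/orP; right; apply: subset_leq_card.
by apply/fintype.subsetP => x; rewrite !inE.
Qed.

(** With [a = q - 1] the left side is [h_q delta * ln q]: up to sign,
    [h_q] is the Legendre transform of the log-partition function of one
    [F]-valued variable. Writing [S = 1 + a * exp (- t)], the difference of the
    two sides is the relative entropy of [(1 - delta, delta)] with respect to
    [(1 / S, a * exp (- t) / S)]; it is nonnegative by [ln y <= y - 1]. *)
Lemma h_legendre_le {R : realType} (delta a t : R)
    (hdelta : 0 < delta < 1) (ha : 0 < a) :
  - (1 - delta) * ln (1 - delta) - delta * ln (delta / a)
  <= ln (1 + a * expR (- t)) + delta * t.
Proof.
have /andP[d0 d1] := hdelta.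
set S := 1 + a * expR (- t).
have e0 : 0 < a * expR (- t) by rewrite mulr_gt0 ?expR_gt0.
have S0 : 0 < S by rewrite addr_gt0.
have lnle (y : R) : 0 < y -> ln y <= y - 1.
  move=> y0; rewrite -{1}[y](subrK 1) addrC le_ln1Dx//; lra.
have h1 : (1 - delta) * ln (((1 - delta) * S)^-1) <= S^-1 - (1 - delta).
  rewrite (_ : S^-1 - _ = (1 - delta) * (((1 - delta) * S)^-1 - 1)).
    by rewrite ler_pM2l ?subr_gt0// lnle// invr_gt0 mulr_gt0// subr_gt0.
  by field; rewrite !gt_eqF//=; lra.
have h2 : delta * ln (a * expR (- t) / (delta * S))
    <= a * expR (- t) / S - delta.
  rewrite (_ : _ / S - _ = delta * (a * expR (- t) / (delta * S) - 1)).
    by rewrite ler_pM2l// lnle// divr_gt0// mulr_gt0.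
  by field; rewrite !gt_eqF.
have hS : S^-1 + a * expR (- t) / S = 1.
  by rewrite -{1}[S^-1]mul1r -mulrDl divff// gt_eqF.
move: h1 h2; rewrite lnV ?posrE ?mulr_gt0 ?subr_gt0//.
rewrite !ln_div ?lnM ?posrE ?mulr_gt0 ?expR_gt0 ?subr_gt0// expRK.
by nra.
Qed.

(** * From edges to linear constraints *)

Lemma edge_ends {V : finType} (H : sgraph V) (e : {e | e \in edges H}) :
  exists p : V * V, val e == [set p.1; p.2].
Proof. by have /imsetP[p _ ->] := valP e; exists p. Qed.

Lemma set2_eq {V : finType} (u w a b : V) :
  [set u; w] = [set a; b] -> (u, w) = (a, b) \/ (u, w) = (b, a).
Proof.
move=> /setP E.
have := E u; have := E w; have := E a; have := E b; rewrite !inE !eqxx /= !orbT.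
move=> /orP[]/eqP-> /orP[]/eqP-> /esym/orP[]/eqP eqw /esym/orP[]/eqP equ.
all: by subst; auto.
Qed.

Theorem lemma14 (R : realType) (p k q : nat) (hp : prime p) (hk : (0 < k)%N)
    (hq : q = (p ^ k)%N) (F : finFieldType) (hF : #|F| = q)
    (delta : R) (hdelta : 0 < delta < 1 - q%:R^-1)
    (V : finType) (H : sgraph V) (r : V) (v m : nat)
    (hv : #|V| = v) (hm : #|edges H| = m) :
  v%:R - 1 - m%:R + m%:R * h_q q delta <= Phi F H r delta.
Proof.
have q1 : (1 < q)%N by rewrite hq -(exp1n k) ltn_exp2r ?prime_gt1.
have Q1 : 1 < q%:R :> R by rewrite ltr1n.
have Q0 : 0 < q%:R :> R by apply: lt_trans Q1.
have lnQ : 0 < ln q%:R :> R by rewrite ln_gt0.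
have /andP[d0 dQ] := hdelta.
have Qi : 0 < q%:R^-1 :> R by rewrite invr_gt0.
have d1 : delta < 1 by lra.
pose I : finType := {e : {set V} | e \in edges H}.
have cardI : #|I| = m by rewrite card_sig -hm; apply: eq_card.
pose ends (e : I) : V * V := xchoose (edge_ends H e).
have endsE (e : I) : val e = [set (ends e).1; (ends e).2].
  exact/eqP/(xchooseP (edge_ends H e)).
(* The edge [e] is cut by [x] exactly when the linear form [f e] is nonzero
   at [x]; the orientation chosen by [ends] only affects its sign. *)
pose f (e : I) (x : {ffun V -> F}) : F := x (ends e).1 - x (ends e).2.
have fB e : {morph f e : x y / x - y}.
  by move=> x y; rewrite /f !ffunE; ring.
pose d (e : I) (x : Omega F r) : bool := f e (val x) != 0.
have z0 : [ffun _ : V => 0 : F] r == 0 by rewrite ffunE.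
pose z : Omega F r := Sub [ffun=> 0] z0.
have dz e : ~~ d e z by rewrite /d /f /= !ffunE subrr eqxx.
have [lam lam0 kkt] := gibbs_kkt d delta z dz d0.
pose mu := gibbs d lam.
have mu_feasible : feasible H delta mu.
  split=> [|u w uw]; first exact: gibbs_is_distr z.
  have uwE : [set u; w] \in edges H by apply/imsetP; exists (u, w); rewrite ?inE.
  pose e : I := Sub [set u; w] uwE.
  apply: le_trans (proj1 (kkt e)); rewrite /Pr le_eqVlt; apply/orP; left.
  apply/eqP/eq_bigl => x; rewrite /d /f subr_eq0.
  by have [[-> ->]|[-> ->]] := set2_eq _ _ _ _ (endsE e); rewrite // eq_sym.
have [_ Phi_ub] := Phi_max F H r (ltW d0).
apply: le_trans (Phi_ub _ mu_feasible).
rewrite hF (entropy_gibbs d q lam z) ler_pdivlMr//.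
under eq_bigr do rewrite (proj2 (kkt _)).
pose S := [set x : {ffun V -> F} | x r == 0].
have SB : {in S &, forall x y, x - y \in S}.
  by move=> x y; rewrite !inE !ffunE => /eqP-> /eqP->; rewrite subrr.
have S0 : (0 < #|S|)%N by apply/card_gt0P; exists (val z); rewrite inE.
have ZE : \sum_(x in S) \prod_(e : I | f e x != 0) expR (- lam e)
    = partition_fun d lam.
  have SE x : (x \in S) = (x \in [pred x : {ffun V -> F} | x r == 0]).
    by rewrite !inE.
  rewrite (eq_bigl _ _ SE) big_sub; apply: eq_bigr => x _.
  by rewrite /gibbs_weight -sumrN expR_sum.
have lnS : (v%:R - 1) * ln q%:R <= ln #|S|%:R :> R.
  have SR : 0 < #|S|%:R :> R by rewrite ltr0n.
  rewrite mulrBl mul1r lerBlDl -lnM ?posrE// [leLHS]mulr_natl -lnXn//.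
  rewrite ler_ln ?posrE ?exprn_gt0 ?mulr_gt0// -natrX -natrM ler_nat.
  by rewrite -hF -hv; exact: card_rooted_ge.
have := ln_weighted_sum_ge f fB lam lam0 S SB S0.
rewrite ZE hF => lnZ.
have hE : h_q q delta * ln q%:R
    = - (1 - delta) * ln (1 - delta) - delta * ln (delta / (q%:R - 1)).
  by rewrite /h_q /logq; field; rewrite gt_eqF.
have : \sum_(e : I) (h_q q delta - 1) * ln q%:R
    <= \sum_(e : I) (ln (1 + (q%:R - 1) * expR (- lam e)) - ln q%:R + lam e * delta).
  apply: ler_sum => e _; rewrite mulrBl hE mul1r.
  have := @h_legendre_le R delta (q%:R - 1) (lam e).
  by rewrite d0 d1 subr_gt0 Q1 [lam e * _]mulrC => /(_ isT isT); lra.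
rewrite sumr_const cardI -[X in X <= _]mulr_natl big_split/=; lra.
Qed.
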